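(* Let $X$ and $\mathbb X$ be two CS set stratifications of the same underlying space with $\mathbb X$ coarsening $X$, let $\nu:X\to\mathbb X$ be the identity map, and suppose $\mathbb X$ is adapted to the ts-coefficient system $\mathcal E$. Suppose $\vec p$ is a ts-perversity on $X$ that can be pushed to $\mathbb X$. For any singular stratum $S$ of $X$, let $\tilde S$ denote any stratum of $X$ such that $(\tilde S)^\nu=S^\nu$ and $\dim(\tilde S)=\dim(S^\nu)$. Then $\vec p$ and $\nu_*\vec p$ are $\mathcal E$-compatible if the following conditions hold for every singular stratum $S$ of $X$: 1. If $\tilde S$ is singular then $\vec p_1(\tilde S)\le\vec p_1(S)\le\vec p_1(\tilde S)+\mathrm{codim}(S)-\mathrm{codim}(\tilde S)$, and furthermore (a) if $\vec p_1(\tilde S)=\vec p_1(S)$ then $\vec p_2(\tilde S)\subset\vec p_2(S)$; (b) if $\vec p_1(S)=\vec p_1(\tilde S)+\mathrm{codim}(S)-\mathrm{codim}(\tilde S)$ then $\vec p_2(\tilde S)\supset\vec p_2(S)$. 2. If $\tilde S$ is regular then $-1\le\vec p_1(S)\le\mathrm{codim}(S)-1$, and furthermore (a) if $\vec p_1(S)=-1$ then $H^1(\mathcal E_x)=0$ and $H^0(\mathcal E_x)$ is $\vec p_2(S)$-torsion for all $x\in S$; (b) if $\vec p_1(S)=0$ then $H^1(\mathcal E_x)$ is $\vec p_2(S)$-torsion for all $x\in S$; (c) if $\vec p_1(S)=\mathrm{codim}(S)-2$ then $H^0(\mathcal E_x)$ is $\vec p_2(S)$-torsion free for all $x\in S$;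 (d) if $\vec p_1(S)=\mathrm{codim}(S)-1$ then $H^0(\mathcal E_x)=0$ and $H^1(\mathcal E_x)$ is $\vec p_2(S)$-torsion free for all $x\in S$.
   Context: **CS sets.** An $n$-dimensional CS set is a Hausdorff space $X$ with a filtration by closed subsets $X=X^n\supset X^{n-1}\supset\cdots\supset X^0\supset X^{-1}=\emptyset$ such that each $X_k:=X^k-X^{k-1}$ is a (possibly empty) $k$-manifold and each $x\in X_k$ has an open neighborhood $U$ in $X_k$, an open neighborhood $N$ in $X$ (a distinguished neighborhood), a compact filtered space $L$ (possibly empty; a link of $x$), and a homeomorphism $h:U\times cL\to N$ with $h(U\times c(L^j))=X^{k+j+1}\cap N$ for all $j$, where $cL$ is the open cone ($cL$ is a point if $L=\emptyset$). All CS sets are assumed paracompact and with $X-X^{n-1}$ dense. The strata are the connected components of the $X_k$; they are regular if $k=n$ and singular if $k<n$; $\mathrm{codim}(S)=n-\dim(S)$. If $X,\mathbb X$ are two stratifications of the same space, $\mathbb X$ coarsens $X$ if each stratum of $\mathbb X$ is a union of strata of $X$. For a stratum $S$ of $X$, $S^\nu$ denotes the stratum of $\mathbb X$ containing it. **Coefficients.** $R$ is a fixed PID and $P(R)$ is its set of primes up to units. For $\wp\subset P(R)$ and an $R$-module $A$, $T^\wp A$ is the submodule of elements annihilated by some finite product of powers of primes in $\wp$ (the empty product is $1$); $A$ is $\wp$-torsion if $T^\wp A=A$ and $\wp$-torsion free if $T^\wp A=0$. A complex of sheaves (of $R$-modules) $\mathcal E$ on a space is a $\wp$-coefficient system if $\mathcal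 H^1(\mathcal E)$ is locally constant with finitely generated $\wp$-torsion stalks, $\mathcal H^0(\mathcal E)$ is locally constant with finitely generated $\wp$-torsion free stalks, and $\mathcal H^i(\mathcal E)=0$ for $i\ne 0,1$. A ts-coefficient system is a complex whose restriction to each component of the space is a $\wp$-coefficient system for some $\wp$ (which may vary by component). If $\mathcal E$ is a ts-coefficient system defined on a subset $\mathrm{Dom}(\mathcal E)$ of $X$, then $X$ is adapted to $\mathcal E$ if $X-X^{n-1}\subset \mathrm{Dom}(\mathcal E)$. **ts-perversities and pushforwards.** A ts-perversity on $X$ is a function $\vec p=(\vec p_1,\vec p_2):\{\text{singular strata of }X\}\to\mathbb Z\times 2^{P(R)}$. The ts-perversity $\vec p$ on $X$ can be pushed to $\mathbb X$ if $\vec p(Y)=\vec p(Z)$ for any two singular strata $Y,Z$ of $X$ such that $Y^\nu=Z^\nu$, $Y^\nu$ is singular in $\mathbb X$, and $\dim(Y)=\dim(Z)=\dim(Y^\nu)$. In this case the pushforward $\nu_*\vec p$ is the ts-perversity on $\mathbb X$ defined by $\nu_*\vec p(\mathbb S)=\vec p(S)$ for any stratum $S$ of $X$ with $S^\nu=\mathbb S$ and $\dim(S)=\dim(\mathbb S)$ (such $S$ always exists). **$\mathcal E$-compatibility.** Let $\mathbb X$ coarsen $X$, with $\mathbb X$ adapted to $\mathcal E$, and let $\vec p$, $\vec q$ be ts-perversities on $X$, $\mathbb X$. They are $\mathcal E$-compatible if the following hold whenever a singular stratum $S$ of $X$ is contained in a stratum $\mathbb S$ of $\mathbb X$. (1)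 If $\mathbb S$ is singular then $\vec q_1(\mathbb S)\le\vec p_1(S)\le\vec q_1(\mathbb S)+\mathrm{codim}(S)-\mathrm{codim}(\mathbb S)$; moreover, if $\vec p_1(S)=\vec q_1(\mathbb S)$ then $\vec p_2(S)\supset\vec q_2(\mathbb S)$, and if $\vec p_1(S)=\vec q_1(\mathbb S)+\mathrm{codim}(S)-\mathrm{codim}(\mathbb S)$ then $\vec p_2(S)\subset\vec q_2(\mathbb S)$. (2) If $\mathbb S$ is regular then $-1\le\vec p_1(S)\le\mathrm{codim}(S)-1$; moreover (a) if $\vec p_1(S)=-1$ then $H^1(\mathcal E_x)=0$ and $H^0(\mathcal E_x)$ is $\vec p_2(S)$-torsion for all $x\in S$; (b) if $\vec p_1(S)=0$ then $H^1(\mathcal E_x)$ is $\vec p_2(S)$-torsion for all $x\in S$; (c) if $\vec p_1(S)=\mathrm{codim}(S)-2$ then $H^0(\mathcal E_x)$ is $\vec p_2(S)$-torsion free for all $x\in S$; (d) if $\vec p_1(S)=\mathrm{codim}(S)-1$ then $H^0(\mathcal E_x)=0$ and $H^1(\mathcal E_x)$ is $\vec p_2(S)$-torsion free for all $x\in S$. *)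

(* Defs.v *)
From HB Require Import structures.
From mathcomp Require Import all_boot all_order all_algebra.
From mathcomp Require Import generic_quotient ring.
From mathcomp Require Import all_classical all_reals all_analysis.

Set Implicit Arguments.
Unset Strict Implicit.
Unset Printing Implicit Defensive.
Import Order.TTheory GRing.Theory Num.Theory.
Import numFieldTopology.Exports.
Local Open Scope classical_set_scope.
Local Open Scope ring_scope.

Section Modules.
Context {R : pzRingType}.

Record submodule (V : lmodType R) := Submodule {
  submod_mem :> V -> Prop;
  submod0 : submod_mem 0;
  submodP : forall (a : R) u v,
    submod_mem u -> submod_mem v -> submod_mem (a *: u + v) }.

Section Sub.
Context {V : lmodType R} (S : submodule V).

Definition submod_type := {x : V | x \in (S : set V)}.

Fact submod_type_closed : submod_closed [pred x : V | x \in (S : set V)].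
Proof.
split=> [|a u v]; rewrite !inE/= ?inE; first exact: submod0.
exact: submodP.
Qed.

HB.instance Definition _ := SubChoice.on submod_type.
HB.instance Definition _ :=
  GRing.SubChoice_isSubLmodule.Build R V _ submod_type submod_type_closed.

End Sub.

Section Quotient.
Context {V : lmodType R} (S : submodule V).

Definition quotmod_rel (x y : V) : bool := `[< S (x - y) >].

Fact submodN x : S x -> S (- x).
Proof. by move=> Sx; have := submodP (-1) Sx (submod0 S); rewrite addr0 scaleN1r. Qed.

Fact submodD x y : S x -> S y -> S (x + y).
Proof. by move=> Sx Sy; have := submodP 1 Sx Sy; rewrite scale1r. Qed.

Fact submodZ a x : S x -> S (a *: x).
Proof. by move=> Sx; have := submodP a Sx (submod0 S); rewrite addr0. Qed.

Fact quotmod_equiv : equiv_class_of quotmod_rel.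
Proof.
split=> [x|x y|y x z].
- by apply/asboolP; rewrite subrr; exact: submod0.
- by apply/asboolP/asboolP => /submodN; rewrite opprB.
- move=> /asboolP xy /asboolP yz; apply/asboolP.
  by have := submodD xy yz; rewrite addrA subrK.
Qed.

Canonical quotmod_equivRel := EquivRelPack quotmod_equiv.

Definition quotmod := {eq_quot quotmod_equivRel}%qT.

HB.instance Definition _ := Choice.on quotmod.

Definition quotmod_pi (x : V) : quotmod := \pi_quotmod%qT x.

Fact quotmod_eqP x y : quotmod_pi x = quotmod_pi y <-> S (x - y).
Proof.
by split=> [/eqmodP/asboolP|h] //; apply/eqmodP/asboolP.
Qed.

Fact quotmod_repr (u : quotmod) : quotmod_pi (repr u) = u.
Proof. exact: reprK. Qed.

Definition quotmod_add (u v : quotmod) := quotmod_pi (repr u + repr v).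
Definition quotmod_opp (u : quotmod) := quotmod_pi (- repr u).
Definition quotmod_scale (a : R) (u : quotmod) := quotmod_pi (a *: repr u).

Fact quotmod_repr_pi x : S (repr (quotmod_pi x) - x).
Proof. by apply/quotmod_eqP; exact: quotmod_repr. Qed.

Fact quotmod_piD x y :
  quotmod_pi (x + y) = quotmod_add (quotmod_pi x) (quotmod_pi y).
Proof.
apply/esym/quotmod_eqP; rewrite opprD addrACA.
by apply: submodD; exact: quotmod_repr_pi.
Qed.

Fact quotmod_piN x : quotmod_pi (- x) = quotmod_opp (quotmod_pi x).
Proof.
by apply/quotmod_eqP; rewrite opprK addrC; exact: quotmod_repr_pi.
Qed.

Fact quotmod_piZ a x : quotmod_pi (a *: x) = quotmod_scale a (quotmod_pi x).
Proof.
apply/esym/quotmod_eqP; rewrite -scalerBr.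
by apply: submodZ; exact: quotmod_repr_pi.
Qed.

Fact quotmod_ind (P : quotmod -> Prop) :
  (forall x, P (quotmod_pi x)) -> forall u, P u.
Proof. by move=> h u; rewrite -[u]quotmod_repr. Qed.

Fact quotmod_addA : associative quotmod_add.
Proof.
elim/quotmod_ind=> x; elim/quotmod_ind=> y; elim/quotmod_ind=> z.
by rewrite -!quotmod_piD addrA.
Qed.
Fact quotmod_addC : commutative quotmod_add.
Proof.
by elim/quotmod_ind=> x; elim/quotmod_ind=> y; rewrite -!quotmod_piD addrC.
Qed.
Fact quotmod_add0 : left_id (quotmod_pi 0) quotmod_add.
Proof. by elim/quotmod_ind=> x; rewrite -quotmod_piD add0r. Qed.
Fact quotmod_addN : left_inverse (quotmod_pi 0) quotmod_opp quotmod_add.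
Proof. by elim/quotmod_ind=> x; rewrite -quotmod_piN -quotmod_piD addNr. Qed.

HB.instance Definition _ := GRing.isZmodule.Build quotmod
  quotmod_addA quotmod_addC quotmod_add0 quotmod_addN.

Fact quotmod_scaleA a b u :
  quotmod_scale a (quotmod_scale b u) = quotmod_scale (a * b) u.
Proof. by elim/quotmod_ind: u => x; rewrite -!quotmod_piZ scalerA. Qed.
Fact quotmod_scale1 : left_id 1 quotmod_scale.
Proof. by elim/quotmod_ind=> x; rewrite -quotmod_piZ scale1r. Qed.
Fact quotmod_scaleDr : right_distributive quotmod_scale +%R.
Proof.
move=> a; elim/quotmod_ind=> x; elim/quotmod_ind=> y; rewrite /GRing.add /=.
by rewrite -!(quotmod_piD, quotmod_piZ) scalerDr.
Qed.
Fact quotmod_scaleDl u : {morph quotmod_scale^~ u : a b / a + b >-> a + b}.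
Proof.
elim/quotmod_ind: u => x a b; rewrite /= -!quotmod_piZ scalerDl.
exact: quotmod_piD.
Qed.

HB.instance Definition _ := GRing.Zmodule_isLmodule.Build R quotmod
  quotmod_scaleA quotmod_scale1 quotmod_scaleDr quotmod_scaleDl.

Fact quotmod_pi_linear : linear quotmod_pi.
Proof. by move=> a x y; rewrite quotmod_piD quotmod_piZ. Qed.

HB.instance Definition _ := GRing.isLinear.Build R V quotmod _ quotmod_pi
  quotmod_pi_linear.

End Quotient.

Section QuotientMap.
Context {V W : lmodType R} (S : submodule V) (S' : submodule W).
Variables (f : {linear V -> W}) (fS : forall x, S x -> S' (f x)).

Definition quotmod_map (u : quotmod S) : quotmod S' := quotmod_pi S' (f (repr u)).

Fact quotmod_mapE x : quotmod_map (quotmod_pi S x) = quotmod_pi S' (f x).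
Proof.
by apply/quotmod_eqP; rewrite -linearB; apply: fS; exact: quotmod_repr_pi.
Qed.

Fact quotmod_map_linear : linear quotmod_map.
Proof.
move=> a u v; rewrite -[u]quotmod_repr -[v]quotmod_repr.
by move: (repr u) (repr v) => x y; rewrite -linearP !quotmod_mapE !linearP.
Qed.

End QuotientMap.

(* The cohomology at V of U --f--> V --g--> W. *)
Section Cohomology.
Context {U V W : lmodType R} (f : {linear U -> V}) (g : {linear V -> W}).

Fact kernel_closed a u v : g u = 0 -> g v = 0 -> g (a *: u + v) = 0.
Proof. by move=> gu gv; rewrite linearP gu gv scaler0 addr0. Qed.

Definition ker_submodule : submodule V :=
  @Submodule V (fun v => g v = 0) (linear0 g) kernel_closed.

Definition is_boundary (z : submod_type ker_submodule) := exists u, f u = val z.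

Fact boundaries0 : is_boundary 0.
Proof. by exists 0; rewrite linear0. Qed.

Fact boundaries_closed a x y :
  is_boundary x -> is_boundary y -> is_boundary (a *: x + y).
Proof. by move=> [u fu] [v fv]; exists (a *: u + v); rewrite linearP fu fv. Qed.

Definition boundaries : submodule (submod_type ker_submodule) :=
  Submodule boundaries0 boundaries_closed.

Definition cohomology : lmodType R := quotmod boundaries.

End Cohomology.

Section CohomologyMap.
Context {U V W U' V' W' : lmodType R}.
Variables (f : {linear U -> V}) (g : {linear V -> W}).
Variables (f' : {linear U' -> V'}) (g' : {linear V' -> W'}).
Variables (a : {linear U -> U'}) (b : {linear V -> V'}) (c : {linear W -> W'}).
Hypothesis bf : forall u, b (f u) = f' (a u).
Hypothesis cg : forall v, c (g v) = g' (b v).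

Fact kernel_map_proof (z : submod_type (ker_submodule g)) :
  b (val z) \in (ker_submodule g' : set V').
Proof.
by apply/mem_set; rewrite /= -cg; case: z => z /= /set_mem ->; rewrite linear0.
Qed.

Definition kernel_map (z : submod_type (ker_submodule g)) : submod_type (ker_submodule g') :=
  Sub (b (val z)) (kernel_map_proof z).

Fact kernel_map_linear : linear kernel_map.
Proof. by move=> k x y; apply/val_inj; rewrite /= linearP. Qed.

HB.instance Definition _ := GRing.isLinear.Build R _ _ _ kernel_map
  kernel_map_linear.

Fact kernel_map_boundaries z :
  boundaries f g z -> boundaries f' g' (kernel_map z).
Proof. by move=> [u fu]; exists (a u); rewrite /= -bf fu. Qed.

Definition cohomology_fun : cohomology f g -> cohomology f' g' :=
  @quotmod_map _ _ (boundaries f g) (boundaries f' g') kernel_map.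

Definition cohomology_map : {linear cohomology f g -> cohomology f' g'} :=
  HB.pack cohomology_fun
    (GRing.isLinear.Build R _ _ _ cohomology_fun
      (quotmod_map_linear kernel_map_boundaries)).

Fact cohomology_mapE z :
  cohomology_map (quotmod_pi (boundaries f g) z) =
  quotmod_pi (boundaries f' g') (kernel_map z).
Proof. exact: (quotmod_mapE kernel_map_boundaries). Qed.

End CohomologyMap.

Section DependentFunctions.
Context {I : Type} (P : I -> Prop) (M : I -> lmodType R).

Definition dfun := forall i, P i -> M i.

HB.instance Definition _ := gen_eqMixin dfun.
HB.instance Definition _ := gen_choiceMixin dfun.

Fact dfun_ext (s t : dfun) : (forall i h, s i h = t i h) -> s = t.
Proof. by move=> st; apply/functional_extensionality_dep => i; apply/funext. Qed.

Definition dfun_add (s t : dfun) : dfun := fun i h => s i h + t i h.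
Definition dfun_opp (s : dfun) : dfun := fun i h => - s i h.
Definition dfun_zero : dfun := fun i h => 0.
Definition dfun_scale (a : R) (s : dfun) : dfun := fun i h => a *: s i h.

Fact dfun_addA : associative dfun_add.
Proof. by move=> *; apply/dfun_ext=> *; exact: addrA. Qed.
Fact dfun_addC : commutative dfun_add.
Proof. by move=> *; apply/dfun_ext=> *; exact: addrC. Qed.
Fact dfun_add0 : left_id dfun_zero dfun_add.
Proof. by move=> *; apply/dfun_ext=> *; exact: add0r. Qed.
Fact dfun_addN : left_inverse dfun_zero dfun_opp dfun_add.
Proof. by move=> *; apply/dfun_ext=> *; exact: addNr. Qed.

HB.instance Definition _ := GRing.isZmodule.Build dfun
  dfun_addA dfun_addC dfun_add0 dfun_addN.

Fact dfun_scaleA a b u : dfun_scale a (dfun_scale b u) = dfun_scale (a * b) u.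
Proof. by apply/dfun_ext=> *; exact: scalerA. Qed.
Fact dfun_scale1 : left_id 1 dfun_scale.
Proof. by move=> *; apply/dfun_ext=> *; exact: scale1r. Qed.
Fact dfun_scaleDr : right_distributive dfun_scale +%R.
Proof. by move=> *; apply/dfun_ext=> *; exact: scalerDr. Qed.
Fact dfun_scaleDl u : {morph dfun_scale^~ u : a b / a + b >-> a + b}.
Proof. by move=> *; apply/dfun_ext=> *; exact: scalerDl. Qed.

HB.instance Definition _ := GRing.Zmodule_isLmodule.Build R dfun
  dfun_scaleA dfun_scale1 dfun_scaleDr dfun_scaleDl.

End DependentFunctions.

Definition zero_module (M : lmodType R) := forall m : M, m = 0.

Definition finitely_generated (M : lmodType R) :=
  exists (k : nat) (g : 'I_k -> M),
    forall m : M, exists c : 'I_k -> R, m = \sum_i c i *: g i.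

End Modules.

Record opens (X : topologicalType) := Opens {
  opens_set :> set X;
  opens_open : open opens_set }.

Definition opens_mem (X : topologicalType) (U : opens X) : X -> Prop := opens_set U.
Coercion opens_mem : opens >-> Funclass.

Definition opens_setI (X : topologicalType) (U V : opens X) : opens X :=
  Opens (openI (opens_open U) (opens_open V)).

Section Presheaves.
Context {R : pzRingType}.

Record presheaf (X : topologicalType) := Presheaf {
  sections :> opens X -> lmodType R;
  restr : forall U V : opens X, V `<=` U -> {linear sections U -> sections V};
  restr_id : forall (U : opens X) (h : U `<=` U) s, restr h s = s;
  restr_comp : forall (U V W : opens X) (h1 : V `<=` U) (h2 : W `<=` V)
    (h3 : W `<=` U) s, restr h2 (restr h1 s) = restr h3 s }.

Arguments restr {X p U V} VU.

Record presheaf_hom (X : topologicalType) (F G : presheaf X) := PresheafHom {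
  hom_app :> forall U : opens X, {linear F U -> G U};
  hom_natural : forall (U V : opens X) (h : V `<=` U) s,
    hom_app V (restr h s) = restr h (hom_app U s) }.

Definition is_isomorphism (X : topologicalType) (F G : presheaf X)
  (phi : presheaf_hom F G) := forall U, bijective (phi U).

Definition isomorphic (X : topologicalType) (F G : presheaf X) :=
  exists phi : presheaf_hom F G, is_isomorphism phi.

Definition is_sheaf (X : topologicalType) (F : presheaf X) :=
  forall (U : opens X) (I : Type) (V : I -> opens X)
    (VU : forall i, V i `<=` U), U `<=` \bigcup_i V i ->
  (forall s t : F U, (forall i, restr (VU i) s = restr (VU i) t) -> s = t) /\
  (forall s : forall i, F (V i),
     (forall i j (hi : opens_setI (V i) (V j) `<=` V i)
        (hj : opens_setI (V i) (V j) `<=` V j),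
        restr hi (s i) = restr hj (s j)) ->
     exists t : F U, forall i, restr (VU i) t = s i).

Record sheaf (X : topologicalType) := Sheaf {
  sheaf_presheaf :> presheaf X;
  sheafP : is_sheaf sheaf_presheaf }.

Section Stalk.
Context {X : topologicalType} (F : presheaf X) (x : X).

Record local_section := LocalSection {
  ls_dom : opens X;
  ls_mem : ls_dom x;
  ls_sec : F ls_dom }.

HB.instance Definition _ := gen_eqMixin local_section.
HB.instance Definition _ := gen_choiceMixin local_section.

Definition germ_rel_prop (s t : local_section) :=
  exists (W : opens X) (hs : W `<=` ls_dom s) (ht : W `<=` ls_dom t),
    W x /\ restr hs (ls_sec s) = restr ht (ls_sec t).

Definition germ_rel (s t : local_section) : bool := `[< germ_rel_prop s t >].

Fact germ_equiv : equiv_class_of germ_rel.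
Proof.
split=> [s|s t|t s u].
- by apply/asboolP; exists (ls_dom s), (@subset_refl _ _), (@subset_refl _ _);
    split=> //; exact: ls_mem.
- by apply/asboolP/asboolP => -[W [hs [ht [Wx e]]]]; exists W, ht, hs.
- move=> /asboolP [W [hs [ht [Wx e]]]] /asboolP [W' [ht' [hu [Wx' e']]]].
  apply/asboolP.
  have l : opens_setI W W' `<=` W by move=> ? [].
  have r : opens_setI W W' `<=` W' by move=> ? [].
  exists (opens_setI W W'), (subset_trans l hs), (subset_trans r hu).
  split; first by split.
  rewrite -(restr_comp hs l) e (restr_comp _ _ (subset_trans l ht)).
  by rewrite -(restr_comp ht' r) e' (restr_comp _ _ (subset_trans r hu)).
Qed.

Canonical germ_equivRel := EquivRelPack germ_equiv.

(* The colimit of the F U over the open neighborhoods U of x. *)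
Definition stalk := {eq_quot germ_equivRel}%qT.

HB.instance Definition _ := Choice.on stalk.

Definition germ_of (s : local_section) : stalk := \pi_stalk%qT s.

Definition germ (U : opens X) (Ux : U x) (s : F U) : stalk :=
  germ_of (LocalSection Ux s).

Fact germ_ofP s t : germ_of s = germ_of t <-> germ_rel_prop s t.
Proof. by split=> [/eqmodP/asboolP|h] //; apply/eqmodP/asboolP. Qed.

Fact germ_of_repr (u : stalk) : germ_of (repr u) = u.
Proof. exact: reprK. Qed.

Fact germ_restr (U V : opens X) (h : V `<=` U) (Ux : U x) (Vx : V x) s :
  germ Vx (restr h s) = germ Ux s.
Proof.
apply/germ_ofP; exists V, (@subset_refl _ _), h; split=> //=.
exact: restr_id.
Qed.

Fact germ_ind (P : stalk -> Prop) :
  (forall U Ux s, P (@germ U Ux s)) -> forall u, P u.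
Proof. by move=> h u; rewrite -[u]germ_of_repr; case: (repr u) => *; exact: h. Qed.

Fact setI_subl (U V : opens X) : opens_setI U V `<=` U.
Proof. by move=> ? []. Qed.
Fact setI_subr (U V : opens X) : opens_setI U V `<=` V.
Proof. by move=> ? []. Qed.

Definition opens_setT : opens X := Opens (@openT X).

Definition stalk_zero : stalk := @germ opens_setT I 0.
Definition stalk_opp (u : stalk) : stalk :=
  germ (ls_mem (repr u)) (- ls_sec (repr u)).
Definition stalk_scale (a : R) (u : stalk) : stalk :=
  germ (ls_mem (repr u)) (a *: ls_sec (repr u)).
Definition stalk_add (u v : stalk) : stalk :=
  @germ (opens_setI (ls_dom (repr u)) (ls_dom (repr v)))
    (conj (ls_mem (repr u)) (ls_mem (repr v)))
    (restr (@setI_subl _ _) (ls_sec (repr u)) +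
     restr (@setI_subr _ _) (ls_sec (repr v))).

Fact germ0 (U : opens X) (Ux : U x) : germ Ux 0 = stalk_zero.
Proof.
have h : U `<=` opens_setT by [].
by rewrite /stalk_zero -(germ_restr h _ Ux) linear0.
Qed.

Fact germN (U : opens X) (Ux : U x) s : germ Ux (- s) = stalk_opp (germ Ux s).
Proof.
rewrite /stalk_opp; have := germ_of_repr (germ Ux s).
case: (repr _) => V Vx t /=; rewrite -/(germ Vx t) => /germ_ofP [W [hs [ht /=]]].
move=> [Wx e].
by rewrite -(germ_restr hs _ Wx) -(germ_restr ht _ Wx) !linearN e.
Qed.

Fact germZ (U : opens X) (Ux : U x) a s :
  germ Ux (a *: s) = stalk_scale a (germ Ux s).
Proof.
rewrite /stalk_scale; have := germ_of_repr (germ Ux s).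
case: (repr _) => V Vx t /=; rewrite -/(germ Vx t) => /germ_ofP [W [hs [ht /=]]].
move=> [Wx e].
by rewrite -(germ_restr hs _ Wx) -(germ_restr ht _ Wx) !linearZ e.
Qed.

Fact germD (U : opens X) (Ux : U x) s t :
  germ Ux (s + t) = stalk_add (germ Ux s) (germ Ux t).
Proof.
rewrite /stalk_add.
have := germ_of_repr (germ Ux s); have := germ_of_repr (germ Ux t).
case: (repr (germ Ux t)) => V' Vx' t' /=.
case: (repr (germ Ux s)) => V Vx s' /=.
move=> /germ_ofP [W' [ht' [ht /= [Wx' et]]]] /germ_ofP [W [hs' [hs /= [Wx es]]]].
pose O := opens_setI W W'; have Ox : O x by [].
have OW : O `<=` W by move=> ? [].
have OW' : O `<=` W' by move=> ? [].
have OVV : O `<=` opens_setI V V'.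
  by move=> y [Wy Wy']; split; [exact: (hs' _ Wy) | exact: (ht' _ Wy')].
rewrite -(germ_restr OVV _ Ox) -(germ_restr (subset_trans OW hs) _ Ox) !linearD.
rewrite (restr_comp _ _ (subset_trans OW hs')).
rewrite (restr_comp _ _ (subset_trans OW' ht')).
congr (germ _ (_ + _)).
  by rewrite -(restr_comp hs OW) -(restr_comp hs' OW) es.
rewrite (_ : subset_trans OW hs = subset_trans OW' ht); last exact: Prop_irrelevance.
by rewrite -(restr_comp ht OW') -(restr_comp ht' OW') et.
Qed.

Fact germ_ind2 (P : stalk -> stalk -> Prop) :
  (forall U Ux s t, P (@germ U Ux s) (@germ U Ux t)) -> forall u v, P u v.
Proof.
move=> h; elim/germ_ind=> U Ux s; elim/germ_ind=> V Vx t.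
have Wx : opens_setI U V x by [].
by rewrite -(germ_restr (@setI_subl U V) _ Wx) -(germ_restr (@setI_subr U V) _ Wx).
Qed.

Fact germ_ind3 (P : stalk -> stalk -> stalk -> Prop) :
  (forall U Ux s t r, P (@germ U Ux s) (@germ U Ux t) (@germ U Ux r)) ->
  forall u v w, P u v w.
Proof.
move=> h u v; elim/germ_ind2: u / v => U Ux s t; elim/germ_ind=> V Vx r.
have Wx : opens_setI U V x by [].
rewrite -(germ_restr (@setI_subl U V) _ Wx s) -(germ_restr (@setI_subr U V) _ Wx).
by rewrite -(germ_restr (@setI_subl U V) _ Wx t).
Qed.

Fact stalk_addA : associative stalk_add.
Proof. by apply: germ_ind3 => U Ux s t r; rewrite -!germD addrA. Qed.
Fact stalk_addC : commutative stalk_add.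
Proof. by apply: germ_ind2 => U Ux s t; rewrite -!germD addrC. Qed.
Fact stalk_add0 : left_id stalk_zero stalk_add.
Proof. by elim/germ_ind=> U Ux s; rewrite -(germ0 Ux) -germD add0r. Qed.
Fact stalk_addN : left_inverse stalk_zero stalk_opp stalk_add.
Proof. by elim/germ_ind=> U Ux s; rewrite -germN -germD addNr germ0. Qed.

HB.instance Definition _ := GRing.isZmodule.Build stalk
  stalk_addA stalk_addC stalk_add0 stalk_addN.

Fact stalk_scaleA a b u : stalk_scale a (stalk_scale b u) = stalk_scale (a * b) u.
Proof. by elim/germ_ind: u => U Ux s; rewrite -!germZ scalerA. Qed.
Fact stalk_scale1 : left_id 1 stalk_scale.
Proof. by elim/germ_ind=> U Ux s; rewrite -germZ scale1r. Qed.
Fact stalk_scaleDr : right_distributive stalk_scale +%R.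
Proof.
move=> a; apply: germ_ind2 => U Ux s t; rewrite /GRing.add /=.
by rewrite -!(germD, germZ) scalerDr.
Qed.
Fact stalk_scaleDl u : {morph stalk_scale^~ u : a b / a + b >-> a + b}.
Proof.
elim/germ_ind: u => U Ux s a b; rewrite /= -!germZ scalerDl.
exact: germD.
Qed.

HB.instance Definition _ := GRing.Zmodule_isLmodule.Build R stalk
  stalk_scaleA stalk_scale1 stalk_scaleDr stalk_scaleDl.

Fact germ_linear (U : opens X) (Ux : U x) : linear (germ Ux).
Proof. by move=> a s t; rewrite germD germZ. Qed.

HB.instance Definition _ (U : opens X) (Ux : U x) :=
  GRing.isLinear.Build R (F U) stalk _ (germ Ux) (germ_linear Ux).

End Stalk.

Section StalkMap.
Context {X : topologicalType} (F G : presheaf X) (phi : presheaf_hom F G) (x : X).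

Definition stalk_map (u : stalk F x) : stalk G x :=
  germ (ls_mem (repr u)) (phi _ (ls_sec (repr u))).

Fact stalk_mapE (U : opens X) (Ux : U x) s :
  stalk_map (germ Ux s) = germ Ux (phi U s).
Proof.
rewrite /stalk_map; have := germ_of_repr (germ Ux s).
case: (repr _) => V Vx t /=; rewrite -/(germ Vx t) => /germ_ofP [W [hs [ht /=]]].
move=> [Wx e].
by rewrite -(germ_restr hs _ Wx) -(germ_restr ht _ Wx) -!hom_natural e.
Qed.

Fact stalk_map_linear : linear stalk_map.
Proof.
move=> a; apply: germ_ind2 => U Ux s t.
by rewrite -linearP !stalk_mapE !linearP.
Qed.

HB.instance Definition _ := GRing.isLinear.Build R _ _ _ stalk_map stalk_map_linear.

End StalkMap.

(* The sheaf associated with the presheaf F, pulled back along a continuous map f: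
   its sections over U are the maps y |-> s y in F_(f y), y in U, that are locally
   induced by sections of F. For f = id this is the sheafification of F, and for f
   the inclusion of a subspace it is the restriction of F to that subspace. *)
Section InverseImage.
Context {X Y : topologicalType} (f : Y -> X) (F : presheaf X).

Definition germ_family (U : opens Y) := dfun U (fun y => stalk F (f y)).

Definition locally_induced (U : opens Y) (s : germ_family U) :=
  forall y, U y ->
  exists (W : opens Y) (V : opens X) (WV : forall z, W z -> V (f z)) (t : F V),
    W y /\ forall z (Wz : W z) (Uz : U z), s z Uz = germ (WV z Wz) t.

Fact locally_induced0 (U : opens Y) : locally_induced (0 : germ_family U).
Proof.
by move=> y Uy; exists U, (@opens_setT X), (fun _ _ => I), 0.
Qed.

Fact locally_induced_closed (U : opens Y) a (s t : germ_family U) :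
  locally_induced s -> locally_induced t -> locally_induced (a *: s + t).
Proof.
move=> hs ht y Uy.
have [W [V [WV [s' [Wy es]]]]] := hs y Uy.
have [W' [V' [WV' [t' [Wy' et]]]]] := ht y Uy.
exists (opens_setI W W'), (opens_setI V V').
exists (fun z (h : opens_setI W W' z) => conj (WV z (proj1 h)) (WV' z (proj2 h))).
exists (a *: restr (@setI_subl _ _ _) s' + restr (@setI_subr _ _ _) t').
split=> // z [Wz Wz'] Uz; rewrite linearP /=.
by rewrite (germ_restr _ (WV z Wz)) (germ_restr _ (WV' z Wz')) -(es z Wz Uz) -et.
Qed.

Definition inverse_image_submodule (U : opens Y) : submodule (germ_family U) :=
  Submodule (@locally_induced0 U) (@locally_induced_closed U).

Definition inverse_image_sections (U : opens Y) : lmodType R :=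
  submod_type (inverse_image_submodule U).

Fact inverse_image_secP (U : opens Y) (s : inverse_image_sections U) :
  locally_induced (val s).
Proof. exact: (set_mem (valP s)). Qed.

Definition inverse_image_sec (U : opens Y) (s : germ_family U)
  (hs : locally_induced s) : inverse_image_sections U := Sub s (mem_set hs).

Fact inverse_image_restr_proof (U V : opens Y) (VU : V `<=` U)
  (s : inverse_image_sections U) :
  locally_induced (fun y Vy => val s y (VU y Vy) : stalk F (f y)).
Proof.
move=> y Vy; have [W [Q [WQ [t [Wy e]]]]] := inverse_image_secP s (VU y Vy).
by exists W, Q, WQ, t.
Qed.

Definition inverse_image_restr (U V : opens Y) (VU : V `<=` U)
    (s : inverse_image_sections U) : inverse_image_sections V :=
  inverse_image_sec (inverse_image_restr_proof VU s).

Fact inverse_image_restr_linear (U V : opens Y) (VU : V `<=` U) :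
  linear (inverse_image_restr VU).
Proof. by move=> a s t; apply/val_inj/dfun_ext. Qed.

HB.instance Definition _ (U V : opens Y) (VU : V `<=` U) :=
  GRing.isLinear.Build R _ _ _ (inverse_image_restr VU)
    (inverse_image_restr_linear VU).

Fact inverse_image_restr_id (U : opens Y) (h : U `<=` U) s :
  inverse_image_restr h s = s.
Proof.
apply/val_inj/dfun_ext => y Uy /=; congr (val s y _); exact: Prop_irrelevance.
Qed.

Fact inverse_image_restr_comp (U V W : opens Y) (h1 : V `<=` U) (h2 : W `<=` V)
    (h3 : W `<=` U) s :
  inverse_image_restr h2 (inverse_image_restr h1 s) = inverse_image_restr h3 s.
Proof.
apply/val_inj/dfun_ext => y Uy /=; congr (val s y _); exact: Prop_irrelevance.
Qed.

Definition inverse_image_presheaf : presheaf Y :=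
  @Presheaf Y inverse_image_sections
    (fun U V h => inverse_image_restr h : {linear _ -> _})
    inverse_image_restr_id inverse_image_restr_comp.

Fact inverse_image_is_sheaf : is_sheaf inverse_image_presheaf.
Proof.
move=> U I V VU UV; split=> [s t st|s scomp].
  apply/val_inj/dfun_ext => y Uy; have [i _ Vy] := UV y Uy.
  have := congr1 (fun r : inverse_image_sections (V i) => val r y Vy) (st i).
  by rewrite /= (_ : VU i y Vy = Uy) //; exact: Prop_irrelevance.
have comp i j y (Vi : V i y) (Vj : V j y) : val (s i) y Vi = val (s j) y Vj.
  have := scomp i j (@setI_subl _ _ _) (@setI_subr _ _ _).
  move=> /(congr1 (fun r : inverse_image_sections
    (opens_setI (V i) (V j)) => val r y (conj Vi Vj))) /=.
  rewrite (_ : setI_subl _ = Vi); last exact: Prop_irrelevance.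
  by rewrite (_ : setI_subr _ = Vj) //; exact: Prop_irrelevance.
have cov y (Uy : U y) : {i | V i y}.
  by apply: cid; have [i _ Vy] := UV y Uy; exists i.
pose t : germ_family U := fun y Uy => val (s (sval (cov y Uy))) y (svalP (cov y Uy)).
have ht : locally_induced t.
  move=> y Uy; have [i Vy] := cov y Uy.
  have [W [Q [WQ [r [Wy e]]]]] := inverse_image_secP (s i) Vy.
  exists (opens_setI W (V i)), Q, (fun z (h : opens_setI W (V i) z) => WQ z (proj1 h)), r.
  by split=> // z [Wz Vz] Uz; rewrite /t (comp _ i _ _ Vz); exact: e.
exists (inverse_image_sec ht) => i; apply/val_inj/dfun_ext => y Vy /=.
exact: comp.
Qed.

Definition inverse_image : sheaf Y := Sheaf inverse_image_is_sheaf.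

End InverseImage.

Section InverseImageMap.
Context {X Y : topologicalType} (f : Y -> X).
Context (F G : presheaf X) (phi : presheaf_hom F G).

Fact inverse_image_app_proof (U : opens Y) (s : inverse_image f F U) :
  locally_induced (fun y Uy => stalk_map phi (val s y Uy) : stalk G (f y)).
Proof.
move=> y Uy; have [W [V [WV [t [Wy e]]]]] := inverse_image_secP s Uy.
exists W, V, WV, (phi V t); split=> // z Wz Uz.
by rewrite (e z Wz Uz) stalk_mapE.
Qed.

Definition inverse_image_app (U : opens Y) (s : inverse_image f F U) :
    inverse_image f G U := inverse_image_sec (inverse_image_app_proof s).

Fact inverse_image_app_linear (U : opens Y) : linear (@inverse_image_app U).
Proof. by move=> a s t; apply/val_inj/dfun_ext => y Uy /=; rewrite linearP. Qed.

HB.instance Definition _ (U : opens Y) :=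
  GRing.isLinear.Build R _ _ _ (@inverse_image_app U) (@inverse_image_app_linear U).

Fact inverse_image_app_natural (U V : opens Y) (h : V `<=` U)
    (s : inverse_image f F U) :
  inverse_image_app (restr h s) = restr h (inverse_image_app s).
Proof. by apply/val_inj/dfun_ext. Qed.

Definition inverse_image_map :
    presheaf_hom (inverse_image f F) (inverse_image f G) :=
  @PresheafHom Y (inverse_image f F) (inverse_image f G)
    (fun U => @inverse_image_app U : {linear _ -> _}) inverse_image_app_natural.

End InverseImageMap.

Definition sheafification (X : topologicalType) (F : presheaf X) : sheaf X :=
  inverse_image id F.

Definition restrict_sheaf (X : topologicalType) (A : set X) (F : presheaf X) :
  sheaf (set_type A) := inverse_image (set_val : set_type A -> X) F.

Definition constant_presheaf (X : topologicalType) (M : lmodType R) : presheaf X :=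
  @Presheaf X (fun=> M) (fun _ _ _ => idfun) (fun _ _ _ => erefl)
    (fun _ _ _ _ _ _ _ => erefl).

Definition constant_sheaf (X : topologicalType) (M : lmodType R) : sheaf X :=
  sheafification (constant_presheaf X M).

Definition locally_constant (X : topologicalType) (F : sheaf X) :=
  forall x : X, exists (U : opens X) (M : lmodType R),
    U x /\ isomorphic (restrict_sheaf U F) (constant_sheaf (set_type U) M).

Definition zero_sheaf (X : topologicalType) (F : sheaf X) :=
  forall U : opens X, zero_module (F U).

(* The differential is indexed by pairs (i, j) with i + 1 = j, so that no casts are
   needed to speak of both differentials at the same term of the complex. *)
Record sheaf_complex (X : topologicalType) := SheafComplex {
  cterm :> int -> sheaf X;
  cdiff : forall i j : int, i + 1 = j -> presheaf_hom (cterm i) (cterm j);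
  cdiff_diff : forall (i j k : int) (ij : i + 1 = j) (jk : j + 1 = k)
    (U : opens X) (s : cterm i U), cdiff jk U (cdiff ij U s) = 0 }.

Section ComplexCohomology.
Context {X : topologicalType} (E : sheaf_complex X).

Definition diff_in (i : int) : presheaf_hom (E (i - 1)) (E i) :=
  cdiff E (subrK 1 i).
Definition diff_out (i : int) : presheaf_hom (E i) (E (i + 1)) :=
  cdiff E (erefl (i + 1)).

(* H^i(E_x), the cohomology of the complex of stalks at x *)
Definition stalk_cohomology (i : int) (x : X) : lmodType R :=
  cohomology (stalk_map (diff_in i) (x := x)) (stalk_map (diff_out i) (x := x)).

Definition cohomology_restr (i : int) (U V : opens X) (VU : V `<=` U) :
    {linear cohomology (diff_in i U) (diff_out i U) ->
            cohomology (diff_in i V) (diff_out i V)} :=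
  cohomology_map
    (fun s => esym (hom_natural (diff_in i) VU s))
    (fun s => esym (hom_natural (diff_out i) VU s)).

Fact cohomology_restr_id i (U : opens X) (h : U `<=` U) s :
  cohomology_restr i h s = s.
Proof.
rewrite -[s]quotmod_repr; move: (repr s) => {}s; rewrite /cohomology_restr cohomology_mapE.
by congr quotmod_pi; apply/val_inj; exact: restr_id.
Qed.

Fact cohomology_restr_comp i (U V W : opens X) (h1 : V `<=` U) (h2 : W `<=` V)
    (h3 : W `<=` U) s :
  cohomology_restr i h2 (cohomology_restr i h1 s) = cohomology_restr i h3 s.
Proof.
rewrite -[s]quotmod_repr; move: (repr s) => {}s; rewrite /cohomology_restr !cohomology_mapE.
by congr quotmod_pi; apply/val_inj; exact: restr_comp.
Qed.

Definition cohomology_presheaf (i : int) : presheaf X :=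
  @Presheaf X (fun U => cohomology (diff_in i U) (diff_out i U))
    (@cohomology_restr i) (@cohomology_restr_id i) (@cohomology_restr_comp i).

(* the sheaf written with a calligraphic H^i(E) *)
Definition cohomology_sheaf (i : int) : sheaf X :=
  sheafification (cohomology_presheaf i).

Variable (A : set X).

Definition restrict_term (i : int) : sheaf (set_type A) := restrict_sheaf A (E i).

Definition restrict_diff (i j : int) (ij : i + 1 = j) :
    presheaf_hom (restrict_term i) (restrict_term j) :=
  inverse_image_map set_val (cdiff E ij).

Fact restrict_diff_diff (i j k : int) (ij : i + 1 = j) (jk : j + 1 = k)
    (U : opens (set_type A)) (s : restrict_term i U) :
  restrict_diff jk U (restrict_diff ij U s) = 0.
Proof.
apply/val_inj/dfun_ext => y Uy /=; move: (val s y Uy); apply: germ_ind => V Vx t.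
by rewrite !stalk_mapE cdiff_diff linear0.
Qed.

Definition restrict_complex : sheaf_complex (set_type A) :=
  SheafComplex restrict_diff_diff.

End ComplexCohomology.

End Presheaves.
Arguments presheaf R X : clear implicits.
Arguments sheaf R X : clear implicits.
Arguments sheaf_complex R X : clear implicits.

Section PID.
Context (R : idomainType).

Definition is_ideal (I : set R) :=
  [/\ I 0, forall a b, I a -> I b -> I (a + b) & forall r a, I a -> I (r * a)].

Definition is_PID :=
  forall I : set R, is_ideal I -> exists a, I = [set r * a | r in [set: R]].

Definition divides (a b : R) := exists c, b = c * a.

Definition prime_element (p : R) :=
  [/\ p != 0, p \isn't a GRing.unit &
      forall a b, divides p (a * b) -> divides p a \/ divides p b].

Definition associates (a b : R) := exists2 u, u \is a GRing.unit & b = u * a.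

(* P(R): a prime up to units is represented by its class of associates. *)
Record prime_class := PrimeClass {
  pclass :> set R;
  pclassP : exists2 p, prime_element p & pclass = associates p }.

Definition in_primes (wp : set prime_class) (p : R) :=
  exists2 c, wp c & (c : set R) p.

Definition prime_product (wp : set prime_class) (r : R) :=
  exists2 s : seq (R * nat), {in s, forall pe, in_primes wp pe.1} &
    r = \prod_(pe <- s) pe.1 ^+ pe.2.

Definition torsion_submodule (wp : set prime_class) (M : lmodType R) : set M :=
  [set m | exists2 r, prime_product wp r & r *: m = 0].

Definition torsion (wp : set prime_class) (M : lmodType R) :=
  torsion_submodule wp (M := M) = [set: M].

Definition torsion_free (wp : set prime_class) (M : lmodType R) :=
  torsion_submodule wp (M := M) = [set 0].

Context {X : topologicalType}.

Definition coefficient_system (wp : set prime_class) (E : sheaf_complex R X) :=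
  [/\ locally_constant (cohomology_sheaf E 1),
      forall x, finitely_generated (stalk (cohomology_sheaf E 1) x) /\
                torsion wp (stalk (cohomology_sheaf E 1) x),
      locally_constant (cohomology_sheaf E 0),
      forall x, finitely_generated (stalk (cohomology_sheaf E 0) x) /\
                torsion_free wp (stalk (cohomology_sheaf E 0) x) &
      forall i : int, i <> 0 -> i <> 1 -> zero_sheaf (cohomology_sheaf E i)].

End PID.

Definition ts_coefficient_system (R : idomainType) (X : topologicalType)
    (E : sheaf_complex R X) :=
  forall x : X, exists wp : set (prime_class R),
    coefficient_system wp (restrict_complex E (connected_component [set: X] x)).

Definition homeomorphism (X Y : topologicalType) (h : X -> Y) :=
  exists g : Y -> X, [/\ cancel h g, cancel g h, continuous h & continuous g].

Definition manifold (K : realType) (k : nat) (M : topologicalType) :=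
  hausdorff_space M /\
  forall x : M, exists (U : set M) (V : set 'rV[K]_k)
      (h : set_type U -> set_type V),
    [/\ open U, U x, open V & homeomorphism h].

Definition paracompact (X : topologicalType) :=
  forall C : set (set X), C `<=` open -> \bigcup_(A in C) A = setT ->
  exists D : set (set X),
    [/\ D `<=` open, \bigcup_(B in D) B = setT,
        forall B, D B -> exists2 A, C A & B `<=` A &
        forall x : X, exists2 V, nbhs x V &
          finite_set [set B | D B /\ B `&` V !=set0]].

Section Cone.
Context (K : realType) (L : topologicalType).

Definition unit_ray : set K := [set t | 0 <= t < 1].

(* The open cone (L x [0, 1)) / (L x {0}), a point when L is empty: None is the
   vertex and Some (l, t) is the class of (l, t) for 0 < t < 1. *)
Definition cone := option (L * {t : K | 0 < t < 1})%type.

Definition cone_proj (lt : (L * set_type unit_ray)%type) : cone :=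
  omap (pair lt.1) (insub (val lt.2)).

Definition cone_open : set (set cone) := [set A | open (cone_proj @^-1` A)].

Fact cone_openT : cone_open setT.
Proof. exact: openT. Qed.
Fact cone_openI : setI_closed cone_open.
Proof. by move=> A B oA oB; exact: openI. Qed.
Fact cone_open_bigU (I : Type) (f : I -> set cone) :
  (forall i, cone_open (f i)) -> cone_open (\bigcup_i f i).
Proof.
move=> of_; rewrite /cone_open /= preimage_bigcup.
by apply: bigcup_open => i _; exact: of_.
Qed.

HB.instance Definition _ := Choice.on cone.
HB.instance Definition _ :=
  isOpenTopological.Build cone cone_openT cone_openI cone_open_bigU.

Definition subcone (A : set L) : set cone :=
  [set None] `|` cone_proj @` [set lt | A lt.1].

End Cone.

(* The skeleta are indexed by all integers, with the convention that X^i is empty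
   for i < 0 and is X for i >= n. *)
Record filtration (X : topologicalType) (n : int) := Filtration {
  skel :> int -> set X;
  skel_closed : forall i, closed (skel i);
  skel_mono : forall i, skel i `<=` skel (i + 1);
  skel_neg : forall i, i < 0 -> skel i = set0;
  skel_top : forall i, n <= i -> skel i = setT }.

Definition pure_part (X : topologicalType) n (F : filtration X n) (k : nat) : set X :=
  F k%:Z `\` F (k%:Z - 1).

Definition has_distinguished_nbhd (K : realType) (X : topologicalType) n
    (F : filtration X n) (k : nat) (x : X) :=
  exists (U : set X) (N : set X) (L : topologicalType) (m : int)
      (G : filtration L m) (h : (set_type U * cone K L)%type -> set_type N),
    [/\ U x /\ (exists2 O, open O & U = O `&` pure_part F k),
        N x /\ open N,
        compact [set: L],
        homeomorphism h &
        forall j : int, -1 <= j ->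
          (fun uc => set_val (h uc)) @` [set uc | subcone (G j) uc.2] =
          F (k%:Z + j + 1) `&` N].

Record cs_set (K : realType) (X : topologicalType) (n : nat) := CSSet {
  cs_filtration :> filtration X n%:Z;
  cs_hausdorff : hausdorff_space X;
  cs_manifold : forall k : nat, (k <= n)%N ->
    manifold K k (set_type (pure_part cs_filtration k));
  cs_local : forall (k : nat) (x : X), pure_part cs_filtration k x ->
    has_distinguished_nbhd K cs_filtration k x;
  cs_paracompact : paracompact X;
  cs_dense : dense (~` cs_filtration (n%:Z - 1)) }.

Section Strata.
Context {K : realType} {T : topologicalType} {n : nat}.
Implicit Types X XX : cs_set K T n.

Record stratum X := Stratum {
  stratum_set :> set T;
  sdim : nat;
  stratumP : exists2 x, pure_part X sdim x &
    stratum_set = connected_component (pure_part X sdim) x }.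

Definition stratum_mem X (S : stratum X) : T -> Prop := stratum_set S.
Coercion stratum_mem : stratum >-> Funclass.

Definition regular X (S : stratum X) := sdim S = n.
Definition singular X (S : stratum X) := (sdim S < n)%N.
Definition codim X (S : stratum X) : int := n%:Z - (sdim S)%:Z.

Record singular_stratum X := SingularStratum {
  sing_stratum :> stratum X;
  sing_singular : singular sing_stratum }.

Definition coarsens XX X :=
  forall S' : stratum XX, exists F : set (stratum X),
    (S' : set T) = \bigcup_(S in F) (S : set T).

Fact pure_part_inj X k l x : pure_part X k x -> pure_part X l x -> k = l.
Proof.
suff sub i j : pure_part X i x -> pure_part X j x -> (j <= i)%N.
  by move=> xk xl; apply/eqP; rewrite eqn_leq (sub l k) ?(sub k l).
have mono a (d : nat) : X a `<=` X (a + d%:Z).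
  elim: d => [|d IH]; first by rewrite addr0.
  by rewrite intS addrCA addrC; apply: subset_trans IH (@skel_mono _ _ X _).
move=> [Xi _] [_ nXj]; rewrite leqNgt; apply/negP => ij; apply: nXj.
have -> : j%:Z - 1 = i%:Z + (j - i.+1)%N%:Z.
  by rewrite -subzn // intS; ring.
exact: mono Xi.
Qed.

Fact pure_part_cover X x : exists k, pure_part X k x.
Proof.
suff H (m : nat) : X (m%:Z - 1) x \/ ~ X (m%:Z - 1) x -> X m%:Z x ->
    exists k, pure_part X k x.
  by apply: (H n); [exact: EM | rewrite skel_top].
elim: m => [|m IH] [Xm|nXm] Xm1; [|by exists 0%N| |by exists m.+1].
  by move: Xm; rewrite skel_neg.
by apply: IH; [exact: EM | rewrite intS (addrC 1) addrK in Xm].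
Qed.

Fact stratum_nonempty X (S : stratum X) : exists x, S x.
Proof.
have [x Sx eS] := stratumP S; exists x; rewrite /stratum_mem eS.
exact: connected_component_refl.
Qed.

Fact stratum_through X x : exists S : stratum X, S x.
Proof.
have [k Xkx] := pure_part_cover X x.
exists (Stratum (ex_intro2 _ _ x Xkx erefl)).
exact: connected_component_refl.
Qed.

Fact stratum_eq_set X (S S' : stratum X) x : S x -> S' x -> (S : set T) = S'.
Proof.
have [y yS eS] := stratumP S; have [z zS eS'] := stratumP S'.
rewrite /stratum_mem eS eS' => xS xS'.
have e : sdim S = sdim S'.
  apply: (@pure_part_inj X _ _ x).
    exact: connected_component_sub xS.
  exact: connected_component_sub xS'.
by rewrite (same_connected_component xS) (same_connected_component xS') e.
Qed.

Fact stratum_above XX X (c : coarsens XX X) (S : stratum X) :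
  exists S' : stratum XX, (S : set T) `<=` S'.
Proof.
have [x Sx] := stratum_nonempty S; have [S' S'x] := stratum_through XX x.
exists S'; have [F eF] := c S'.
have [Q FQ Qx] : (\bigcup_(S in F) (S : set T)) x by rewrite -eF.
by rewrite (stratum_eq_set Sx Qx) eF; exact: bigcup_sup.
Qed.

(* S^nu, the stratum of the coarsening XX that contains S *)
Definition nu XX X (c : coarsens XX X) (S : stratum X) : stratum XX :=
  projT1 (cid (stratum_above c S)).

End Strata.

Section Perversities.
Context {K : realType} {R : idomainType} {T : topologicalType} {n : nat}.
Implicit Types X XX : cs_set K T n.

Definition ts_perversity X := singular_stratum X -> int * set (prime_class R).

Definition can_be_pushed XX X (c : coarsens XX X) (p : ts_perversity X) :=
  forall Y Z : singular_stratum X,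
    nu c Y = nu c Z -> singular (nu c Y) ->
    sdim Y = sdim Z -> sdim Z = sdim (nu c Y) -> p Y = p Z.

(* The value of p at any stratum S of X with S^nu = S' and dim(S) = dim(S').  Such an
   S always exists, so the default value (0, set0) is never used. *)
Definition perversity_pushforward XX X (c : coarsens XX X) (p : ts_perversity X) :
    ts_perversity XX := fun S' =>
  if pselect (exists S : singular_stratum X, nu c S = S' /\ sdim S = sdim S')
  is left S_exists then p (projT1 (cid S_exists)) else (0, set0).

Definition adapted X (Dom : set T) := ~` X (n%:Z - 1) `<=` Dom.

Definition E_compatible XX X (Dom : set T) (E : sheaf_complex R (set_type Dom))
    (p : ts_perversity X) (q : ts_perversity XX) :=
  (forall (S : singular_stratum X) (S' : singular_stratum XX),
     (S : set T) `<=` S' ->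
     [/\ (q S').1 <= (p S).1 <= (q S').1 + codim S - codim S',
         (p S).1 = (q S').1 -> (q S').2 `<=` (p S).2 &
         (p S).1 = (q S').1 + codim S - codim S' -> (p S).2 `<=` (q S').2]) /\
  (forall (S : singular_stratum X) (S' : stratum XX),
     (S : set T) `<=` S' -> regular S' ->
     [/\ -1 <= (p S).1 <= codim S - 1,
         (p S).1 = -1 -> forall x : set_type Dom, S (val x) ->
           zero_module (stalk_cohomology E 1 x) /\
           torsion (p S).2 (stalk_cohomology E 0 x),
         (p S).1 = 0 -> forall x : set_type Dom, S (val x) ->
           torsion (p S).2 (stalk_cohomology E 1 x),
         (p S).1 = codim S - 2 -> forall x : set_type Dom, S (val x) ->
           torsion_free (p S).2 (stalk_cohomology E 0 x) &
         (p S).1 = codim S - 1 -> forall x : set_type Dom, S (val x) ->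
           zero_module (stalk_cohomology E 0 x) /\
           torsion_free (p S).2 (stalk_cohomology E 1 x)]).

End Perversities.

(* Main.v *)
Require Import Defs.
From HB Require Import structures.
From mathcomp Require Import all_boot all_order all_algebra.
From mathcomp Require Import all_classical all_reals all_analysis.

Set Implicit Arguments.
Unset Strict Implicit.
Unset Printing Implicit Defensive.
Import Order.TTheory GRing.Theory Num.Theory.
Import numFieldTopology.Exports.
Local Open Scope classical_set_scope.
Local Open Scope ring_scope.

(** Both notions of compatibility compare the value of the perversity at a singular
stratum [S] of [X] with data attached to the stratum of [XX] containing [S].  That
stratum is [nu c S], since a stratum is determined by its underlying set
([nu_eq]), and [tilde S] is a stratum of [X] in it of the same dimension; hence
[tilde S] and [nu c S] have the same codimension and are singular or regular
together.  When they are singular, the pushforward takes at [nu c S] the value of [p]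
at some stratum of full dimension in [nu c S], and this value is the one at [tilde S]
because [p] can be pushed ([pushforwardE]).  The conditions on [S] and [tilde S] are
then the compatibility conditions on [S] and [nu c S]. *)

Section Strata.
Context {K : realType} {T : topologicalType} {n : nat}.
Implicit Types X XX : cs_set K T n.

Lemma stratum_pure_part X (S : stratum X) x : S x -> pure_part X (sdim S) x.
Proof.
have [y _ eS] := stratumP S; rewrite /stratum_mem eS.
exact: connected_component_sub.
Qed.

(** The dimension of a stratum can be read off at any of its points, so that strata
with a common point agree as records and not only as sets. *)
Lemma stratum_eq X (S S' : stratum X) x : S x -> S' x -> S = S'.
Proof.
move=> Sx S'x.
have eset := stratum_eq_set Sx S'x.
have edim := pure_part_inj (stratum_pure_part Sx) (stratum_pure_part S'x).
case: S S' eset edim {Sx S'x} => [A k hA] [B l hB] /= eAB ekl.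
by subst B l; congr Stratum; exact: Prop_irrelevance.
Qed.

Lemma nu_eq XX X (c : coarsens XX X) (S : stratum X) (S' : stratum XX) :
  (S : set T) `<=` S' -> nu c S = S'.
Proof.
move=> SS'; have [x Sx] := stratum_nonempty S.
apply: (@stratum_eq XX _ _ x); last exact: SS'.
exact: (projT2 (cid (stratum_above c S))) Sx.
Qed.

Lemma pushforwardE {R : idomainType} XX X (c : coarsens XX X)
    (p : ts_perversity (R := R) X) (S : singular_stratum X)
    (S' : singular_stratum XX) :
  can_be_pushed c p -> nu c S = S' -> sdim S = sdim S' ->
  perversity_pushforward c p S' = p S.
Proof.
move=> p_pushed nuS dimS; rewrite /perversity_pushforward.
case: pselect => [S_exists|]; last by case; exists S.
case: cid => Z [nuZ dimZ] /=; apply: p_pushed; rewrite ?nuZ ?nuS ?dimZ ?dimS //.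
exact: sing_singular.
Qed.

End Strata.

Theorem proposition3p13 (K : realType) (R : idomainType) (R_PID : is_PID R)
  (T : topologicalType) (n : nat) (X XX : cs_set K T n) (c : coarsens XX X)
  (Dom : set T) (E : sheaf_complex R (set_type Dom))
  (E_ts : ts_coefficient_system E) (XX_adapted : adapted XX Dom)
  (p : ts_perversity X) (p_pushed : can_be_pushed c p)
  (tilde : singular_stratum X -> stratum X)
  (tildeP : forall S : singular_stratum X,
     nu c (tilde S) = nu c S /\ sdim (tilde S) = sdim (nu c S))
  (cond1 : forall (S : singular_stratum X) (tS_singular : singular (tilde S)),
     let tS := SingularStratum tS_singular in
     [/\ (p tS).1 <= (p S).1 <= (p tS).1 + codim S - codim tS,
         (p tS).1 = (p S).1 -> (p tS).2 `<=` (p S).2 &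
         (p S).1 = (p tS).1 + codim S - codim tS -> (p S).2 `<=` (p tS).2])
  (cond2 : forall S : singular_stratum X, regular (tilde S) ->
     [/\ -1 <= (p S).1 <= codim S - 1,
         (p S).1 = -1 -> forall x : set_type Dom, S (val x) ->
           zero_module (stalk_cohomology E 1 x) /\
           torsion (p S).2 (stalk_cohomology E 0 x),
         (p S).1 = 0 -> forall x : set_type Dom, S (val x) ->
           torsion (p S).2 (stalk_cohomology E 1 x),
         (p S).1 = codim S - 2 -> forall x : set_type Dom, S (val x) ->
           torsion_free (p S).2 (stalk_cohomology E 0 x) &
         (p S).1 = codim S - 1 -> forall x : set_type Dom, S (val x) ->
           zero_module (stalk_cohomology E 0 x) /\
           torsion_free (p S).2 (stalk_cohomology E 1 x)]) :
  E_compatible E p (perversity_pushforward c p).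
Proof.
split=> S S' SS'.
  have [nutS dimtS] := tildeP S; rewrite (nu_eq c SS') in nutS dimtS.
  have tS_singular : singular (tilde S).
    by rewrite /singular dimtS; exact: sing_singular.
  have := cond1 S tS_singular; cbv zeta => -[bounds low high].
  rewrite (pushforwardE (S := SingularStratum tS_singular) p_pushed nutS dimtS).
  rewrite /codim /= dimtS in bounds high *.
  by split=> // e; apply: low.
move=> S'_regular; apply: cond2.
by rewrite /regular (tildeP S).2 (nu_eq c SS').
Qed.
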